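(* Let $p$ be a prime, let $1\le U,V<p$ be integers, let ${\mathfrak C}\subseteq[1,U]\times[1,V]$ be a convex set, and let $\{\alpha_u\}_{u=1}^U$, $\{\beta_v\}_{v=1}^V$ be complex numbers with $|\alpha_u|,|\beta_v|\le 1$. For $(a,b)\in{\mathbb F}_p^*\times{\mathbb F}_p$ define $$K_{a,b}({\mathcal A},{\mathcal B};{\mathfrak C})=\sum_{(u,v)\in{\mathfrak C}}\alpha_u\beta_v\,{\mathbf e}_p\big(v/(au+b)\big),$$ where the sum is over integer points $(u,v)\in{\mathfrak C}$ with $au+b\not\equiv0\pmod p$. Then, uniformly over $(a,b)\in{\mathbb F}_p^*\times{\mathbb F}_p$ and over $U,V,{\mathfrak C}$ and the weights, as $p\to\infty$, $$|K_{a,b}({\mathcal A},{\mathcal B};{\mathfrak C})|\le V^{3/4}\Big(U^{7/8}p^{1/8}+U^{1/2}p^{1/4}\Big)p^{o(1)}.$$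
   Context: ${\mathbf e}_p(z)=\exp(2\pi i z/p)$, where $v/(au+b)$ denotes an element of ${\mathbb F}_p$ represented by an integer in $\{0,\dots,p-1\}$. The notation $p^{o(1)}$ denotes a factor $p^{\epsilon(p)}$ with $\epsilon(p)\to0$ as $p\to\infty$. *)

(* Defs.v *)
From HB Require Import structures.
From mathcomp Require Import all_boot all_order all_algebra.
From mathcomp Require Import complex.
From mathcomp Require Import all_classical all_reals all_analysis.

Set Implicit Arguments.
Unset Strict Implicit.
Unset Printing Implicit Defensive.

Import Order.TTheory GRing.Theory Num.Theory.
Import numFieldNormedType.Exports.

Local Open Scope classical_set_scope.
Local Open Scope ring_scope.
Local Open Scope complex_scope.

Definition expC (R : realType) (z : R[i]) : R[i] :=
  (expR (complex.Re z))%:C * (cos (complex.Im z) +i* sin (complex.Im z)).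

Definition e_ (R : realType) (p : nat) (z : R) : R[i] :=
  expC ((2 * pi * z / p%:R)*i).

(* The quotient is taken in 'F_p; for p prime its value as an ordinal is the
   representative in {0, ..., p - 1}. When C is contained in [1, U] x [1, V],
   the ranges below enumerate all the integer points of C. *)
Definition Ksum (R : realType) (p U V : nat) (a b : 'F_p)
    (alpha beta : nat -> R[i]) (C : set (R^o * R^o)) : R[i] :=
  \sum_(1 <= u < U.+1)
    \sum_(1 <= v < V.+1 | (((u%:R, v%:R) : R^o * R^o) \in C)
                          && (a * u%:R + b != 0))
      alpha u * beta v
        * e_ p (nat_of_ord (v%:R / (a * u%:R + b) : 'F_p))%:R.

(* Main.v *)
(** For fixed v the integer points of the convex set form an interval of u.
    Hoelder's inequality in v gives |K|^4 <= V^3 sum_v |sum_u|^4, the inner sum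
    running over that interval; a Rademacher-Menshov dyadic decomposition
    replaces the v-dependent interval by fixed dyadic blocks W at the cost of
    powers of log U, and v is then extended to all of F_p.  By Parseval the
    fourth moment of a block is p times the number of solutions of
      1/x1 + 1/x2 = 1/x3 + 1/x4,   xi = a ui + b,  ui in W.
    It remains to bound, for s <> 0, the number of solutions of
    1/x + 1/y = s, i.e. of (x - 1/s)(y - 1/s) = 1/s^2, i.e. of
    (u + A)(v + A) = kappa <> 0 in F_p with u, v < U.  Dirichlet's theorem gives
    t <= T and a small a0 = t A mod p; the integer m = t u v + a0 (u + v) has
    fixed residue mod p and size O(T U^2 + U p / T), so that, for T about
    sqrt(p / U), it takes O(1 + U^(3/2) p^(-1/2)) values.  Each of them
    determines the nonzero integer (t u + a0)(t v + a0) = a0^2 + t m, and the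
    divisor bound leaves p^o(1) possibilities for (u, v). *)
Require Import Defs.
From mathcomp Require Import all_boot all_order all_algebra.
From mathcomp Require Import complex.
From mathcomp Require Import all_classical all_reals all_analysis.
From mathcomp Require Import zify ring lra.

Import Order.TTheory GRing.Theory Num.Theory.
Import numFieldNormedType.Exports.
Import Normc.

Local Open Scope classical_set_scope.
Local Open Scope ring_scope.
Local Open Scope complex_scope.

(** * The divisor bound *)

Lemma size_add_divisors (f : nat * nat) (s : seq nat) :
  size (PrimeDecompAux.add_divisors f s) = (f.2.+1 * size s)%N.
Proof.
case: f => q e /=; elim: e => [|e IHe] /=; first by rewrite mul1n.
by rewrite size_merge size_cat size_map IHe; lia.
Qed.

Lemma size_divisors (n : nat) :
  size (divisors n) = (\prod_(f <- prime_decomp n) f.2.+1)%N.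
Proof.
rewrite /divisors; elim: (prime_decomp n) => [|f s IHs] /=.
  by rewrite big_nil.
by rewrite size_add_divisors IHs big_cons.
Qed.

(** With [q = e %/ k], one has [e + 1 <= k (q + 1) <= k 2^q]; the [k]-th power of [2^q] is at most
    [2^e]. *)
Lemma succ_expn_le (k e : nat) : (0 < k)%N -> (e.+1 ^ k <= k ^ k * 2 ^ e)%N.
Proof.
move=> k0; apply: (@leq_trans ((k * 2 ^ (e %/ k)) ^ k)).
  rewrite leq_exp2r //; apply: (@leq_trans (k * (e %/ k).+1)).
    by rewrite mulnC; exact: ltn_ceil.
  by rewrite leq_mul2l ltn_expl ?orbT.
by rewrite expnMn leq_mul2l -expnM leq_exp2l // leq_divM orbT.
Qed.

(** Compare prime by prime: if [q >= 2^k], then [(e+1)^k <= 2^(ke) <= q^e] at no cost. Only primes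
    below [2^k] cost a factor [k^k], and there are at most [2^k] of them. *)
Lemma divisor_bound (k n : nat) : (0 < k)%N -> (0 < n)%N ->
  (size (divisors n) ^ k <= (k ^ k) ^ (2 ^ k) * n)%N.
Proof.
move=> k0 n0; rewrite size_divisors [X in (_ <= _ * X)%N](prod_prime_decomp n0).
have kk0 : (0 < k ^ k)%N by rewrite expn_gt0 k0.
have -> (s : seq (nat * nat)) : ((\prod_(f <- s) f.2.+1) ^ k)%N =
    (\prod_(f <- s) f.2.+1 ^ k)%N.
  elim: s => [|f s IHs]; first by rewrite !big_nil exp1n.
  by rewrite !big_cons expnMn IHs.
have small (s : seq nat) : uniq s ->
    (\prod_(q <- s | q < 2 ^ k) k ^ k <= (k ^ k) ^ (2 ^ k))%N.
  move=> us; rewrite big_const_seq iter_muln muln1.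
  rewrite leq_pexp2l // -size_filter -[leqRHS](size_iota 0).
  apply: uniq_leq_size; first exact: filter_uniq.
  by move=> q; rewrite mem_filter mem_iota => /andP[].
apply: (@leq_trans (\prod_(f <- prime_decomp n)
    ((if (f.1 < 2 ^ k)%N then k ^ k else 1) * (f.1 ^ f.2)))%N).
  rewrite big_seq [leqRHS]big_seq; apply: leq_prod => -[q e] /=.
  move=> /mem_prime_decomp[pq e0 _].
  case: ltnP => [_|qk].
    apply: leq_trans (succ_expn_le k e k0) _; rewrite leq_mul2l.
    by rewrite leq_exp2r // prime_gt1 ?orbT.
  rewrite mul1n (leq_trans _ (_ : (2 ^ k) ^ e <= _)%N) //.
    by rewrite -expnM mulnC expnM leq_exp2r // ltn_expl.
  by rewrite leq_exp2r.
rewrite big_split leq_mul2r; apply/orP; right; rewrite -big_mkcond /=.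
rewrite -(big_map fst (fun q => q < 2 ^ k)%N (fun=> (k ^ k)%N)).
by apply: small; rewrite -/(unzip1 _); exact: primes_uniq.
Qed.

(** * Points of a modular hyperbola in a short box *)

(** Pigeonhole: the [T + 1] residues of [t A], [0 <= t <= T], fall into [T] boxes of length [p / T];
    two in the same box are subtracted. *)
Lemma dirichlet_Fp (p T : nat) (A : 'F_p) : prime p -> (0 < T)%N ->
  exists t (a0 : int),
    [/\ (0 < t <= T)%N, a0%:~R = t%:R * A & (`|a0| * T < p)%N].
Proof.
move=> pp T0; have p0 := prime_gt0 pp.
pose r (t : nat) : nat := (t%:R * A : 'F_p).
have rlt t : (r t < p)%N.
  by have := ltn_ord (t%:R * A : 'F_p); rewrite [X in (_ < X)%N -> _](Fp_cast pp).
have flt (t : 'I_T.+1) : ((r t * T) %/ p < T)%N.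
  by rewrite ltn_divLR // mulnC ltn_pmul2l.
have [t1 [t2 [t12 e12]]] : exists t1 t2 : 'I_T.+1,
    (t1 < t2)%N /\ ((r t1 * T) %/ p = (r t2 * T) %/ p)%N.
  have /injectivePn[x [y xy fxy]] : ~~ injectiveb (fun t => Ordinal (flt t)).
    apply/injectiveP => /leq_card; rewrite !card_ord; lia.
  case: fxy => fxy; have : (x : nat) != y by [].
  by rewrite neq_ltn => /orP[] h; [exists x, y | exists y, x].
exists (t2 - t1)%N, ((r t2)%:Z - (r t1)%:Z); split.
- have := ltn_ord t2; lia.
- by rewrite rmorphB /= -!pmulrn !natr_Zp -mulrBl natrB // ltnW.
- have := divn_eq (r t1 * T) p; have := divn_eq (r t2 * T) p; rewrite -e12.
  have := ltn_pmod (r t1 * T) p0; have := ltn_pmod (r t2 * T) p0.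
  move: (_ %/ _)%N (_ %% _)%N (_ %% _)%N => q x y; nia.
Qed.

(* [l u = t u + a0] is a signed divisor of the integer attached to [m u v], and
   [m + X] is a natural number whose residue mod [p] is the same for all of [S];
   a point is recovered from the quotient of [m + X] by [p] and from [l u]. *)
Lemma hyperbola_count (p N T X D : nat) (A kappa : 'F_p)
    (S : {pred 'I_N * 'I_N}) :
  prime p -> (N < p)%N -> (0 < T < p)%N ->
  (T * N ^ 2 + 2 * N * (p %/ T) <= X)%N ->
  (forall n, (0 < n <= p ^ 6)%N -> (size (divisors n) <= D)%N) ->
  kappa != 0 ->
  (forall x, x \in S -> (x.1%:R + A) * (x.2%:R + A) = kappa) ->
  (#|S| <= ((2 * X) %/ p).+1 * (2 * D))%N.
Proof.
move=> pp Np /andP[T0 Tp] TX Ddiv k0 Sk; have p1 := prime_gt1 pp.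
have [t [a0 [/andP[t0 tT] a0E a0T]]] := dirichlet_Fp _ _ A pp T0.
have a0le : (`|a0| <= p %/ T)%N by rewrite leq_divRL // ltnW.
have a0p : (`|a0| < p)%N by apply: leq_ltn_trans a0T; rewrite leq_pmulr.
have tF : (t%:R : 'F_p) != 0.
  rewrite -(dvdn_pcharf (pchar_Fp pp)); apply/negP => /dvdn_leq; lia.
have D0 : (0 < D)%N.
  by apply: leq_trans (Ddiv 1%N _) => //; rewrite expn_gt0 (ltnW p1).
pose l (u : nat) : int := t%:Z * u%:Z + a0.
pose m (u v : nat) : int := t%:Z * u%:Z * v%:Z + a0 * (u%:Z + v%:Z).
have lm u v : l u * l v = a0 * a0 + t%:Z * m u v by rewrite /l /m; ring.
(* This keeps the product [l u * l v] within [p ^ 6], the range where [D] bounds the number of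
   divisors. *)
have lp (u : 'I_N) : (`|l u| <= p ^ 3)%N.
  have := ltn_ord u; rewrite /l => uN.
  have : (t * u <= p * p)%N by apply: leq_mul; lia.
  have : (p * p + p <= p ^ 3)%N by rewrite !expnS expn0; nia.
  by lia.
(* Modulo [p] the product is [t^2 kappa], a unit; hence it is a nonzero integer and has finitely
   many divisors. *)
have lE (x : 'I_N * 'I_N) : x \in S -> ((l x.1 * l x.2)%:~R : 'F_p) = t%:R ^+ 2 * kappa.
  move=> /Sk <-; rewrite /l; rewrite !(rmorphM, rmorphD) /= a0E; ring.
have ln0 (x : 'I_N * 'I_N) : x \in S -> l x.1 * l x.2 != 0.
  move=> xS; apply/eqP => h; have := lE _ xS; rewrite h => /esym/eqP.
  by rewrite mulf_eq0 (negPf k0) expf_eq0 (negPf tF).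
have mX (u v : 'I_N) : (`|m u v| <= X)%N.
  have := ltn_ord u; have := ltn_ord v.
  move: (nat_of_ord u) (nat_of_ord v) => {}u {}v vN uN.
  have h1 : (t * u * v <= T * N ^ 2)%N.
    by rewrite -mulnA; apply: leq_mul => //; rewrite expnS expn1 leq_mul // ltnW.
  have h2 : (`|a0| * (u + v) <= (p %/ T) * (2 * N))%N by apply: leq_mul => //; lia.
  have h3 : (`|m u v| <= t * u * v + `|a0| * (u + v))%N.
    have abszD_le (x y : int) : (`|(x + y)%R| <= `|x| + `|y|)%N by lia.
    by rewrite /m -!PoszM -PoszD; apply: leq_trans (abszD_le _ _) _; rewrite abszM.
  lia.
pose M (x : 'I_N * 'I_N) : nat := `|(m x.1 x.2 + X%:Z)%R|%N.
have ME x : (M x)%:Z = m x.1 x.2 + X%:Z.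
  by have := mX x.1 x.2; rewrite /M; lia.
have Mp x : (M x %/ p < ((2 * X) %/ p).+1)%N.
  by rewrite ltnS leq_div2r //; have := mX x.1 x.2; rewrite /M; lia.
have Mmod x y : x \in S -> y \in S -> (M x %% p = M y %% p)%N.
  (* Since [a0 = t A] modulo [p], [m u v] reduces to [t ((u + A)(v + A) - A^2)]. *)
  have h z : z \in S -> ((M z)%:R : 'F_p) = t%:R * (kappa - A ^+ 2) + X%:R.
    move=> zS; rewrite [LHS]pmulrn ME !(rmorphM, rmorphD) /= a0E -(Sk z zS).
    by rewrite -!pmulrn; ring.
  by move=> xS yS; rewrite -!(val_Fp_nat pp) (h x) // (h y).
pose dv (x : 'I_N * 'I_N) := divisors `|(l x.1 * l x.2)%R|%N.
have dvP x : x \in S -> (index `|l x.1|%N (dv x) < D)%N /\ `|l x.1|%N \in dv x.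
  move=> xS; have n0 : (0 < `|(l x.1 * l x.2)%R|)%N by rewrite absz_gt0 ln0.
  have ldv : `|l x.1|%N \in dv x by rewrite -dvdn_divisors // abszM dvdn_mulr.
  split=> //; apply: (@leq_trans (size (dv x))); first by rewrite index_mem.
  by apply: Ddiv; rewrite n0 abszM (expnD p 3 3) leq_mul.
case: D D0 Ddiv dvP => // D _ Ddiv dvP.
(* The boolean is the sign of [l x.1] and the last index locates its absolute value among the
   divisors, whence the factor [2 * D]. *)
pose g x : 'I_((2 * X) %/ p).+1 * (bool * 'I_D.+1) :=
  (Ordinal (Mp x), (0 <= l x.1, inord (index `|l x.1|%N (dv x)))).
have ginj : {in S &, injective g}.
  move=> x y xS yS [Mxy sxy] /(congr1 val) /=.
  have [ix lx] := dvP x xS; have [iy ly] := dvP y yS.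
  have mxy : m x.1 x.2 = m y.1 y.2.
    have : M x = M y by rewrite (divn_eq (M x) p) (divn_eq (M y) p) Mxy (Mmod x y).
    by move=> /(congr1 Posz); rewrite !ME => /addIr.
  have nxy : l x.1 * l x.2 = l y.1 * l y.2 by rewrite !lm mxy.
  have dxy : dv x = dv y by rewrite /dv nxy.
  rewrite !inordK // => ixy.
  have axy : `|l x.1|%N = `|l y.1|%N.
    by rewrite -(nth_index 0%N lx) -(nth_index 0%N ly) ixy dxy.
  have lxy : l x.1 = l y.1 by rewrite (intEsign (l x.1)) (intEsign (l y.1)) !ltNge sxy axy.
  have linj u v : l u = l v -> u = v.
    have tz : t%:Z != 0 by rewrite -lt0n.
    by move=> /addIr /(mulfI tz) [].
  have l0 : l y.1 != 0 by move: (ln0 y yS); rewrite mulf_eq0 negb_or => /andP[].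
  case: x y {xS yS Mxy sxy ix lx iy ly mxy dxy ixy axy} nxy lxy l0 => [u v] [u' v'] /=.
  move=> nxy lxy l0; rewrite lxy in nxy.
  by congr pair; apply/val_inj/linj => //; exact: (mulfI l0).
rewrite -(card_in_imset ginj); apply: leq_trans (max_card _) _.
by rewrite !card_prod !card_ord card_bool.
Qed.

(** * Additive characters of the prime field and fourth moments *)

Section character.
Variables (R : realType) (p : nat).
Hypothesis pp : prime p.

Definition chi (x : 'F_p) : R[i] := e_ p (nat_of_ord x)%:R.

Let th (z : R) := 2 * pi * z / p%:R.

Lemma e_E (z : R) : e_ p z = cos (th z) +i* sin (th z).
Proof. by rewrite /e_ /expC /= expR0 mul1r. Qed.

Lemma e_D (y z : R) : e_ p (y + z) = e_ p y * e_ p z.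
Proof.
rewrite !e_E /th mulrDr mulrDl cosD sinD; apply/eqP.
by rewrite eq_complex /= eqxx addrC /= mulrC [X in _ + X]mulrC.
Qed.

Lemma e_nat (n : nat) : e_ p (n%:R : R) = e_ p 1 ^+ n.
Proof.
elim: n => [|n IHn]; last by rewrite -addn1 natrD e_D IHn addn1 exprSr.
by rewrite e_E /th mulr0 mul0r cos0 sin0.
Qed.

Lemma e_period : e_ p (1 : R) ^+ p = 1.
Proof.
rewrite -e_nat e_E /th mulfK ?pnatr_eq0 -?lt0n ?prime_gt0 //.
by rewrite mulr_natl cos2pi sin2pi.
Qed.

Lemma chi_nat (n : nat) : chi n%:R = e_ p n%:R.
Proof. by rewrite /chi val_Fp_nat // !e_nat expr_mod // e_period. Qed.

Lemma chiD (x y : 'F_p) : chi (x + y) = chi x * chi y.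
Proof. by rewrite -(natr_Zp x) -(natr_Zp y) -natrD !chi_nat natrD e_D. Qed.

Lemma normc_chi (x : 'F_p) : normc (chi x) = 1.
Proof. by rewrite /chi e_E /= cos2Dsin2 sqrtr1. Qed.

Lemma normc_sqr (z : R[i]) : (normc z ^+ 2)%:C = z * z^*%C.
Proof. by rewrite -sqr_normc rmorphXn. Qed.

Lemma chi0 : chi 0 = 1.
Proof. by rewrite /chi e_nat expr0. Qed.

Lemma chi_conj (x : 'F_p) : (chi x)^*%C = chi (- x).
Proof.
have c0 : chi x != 0.
  apply/eqP => h; have := normc_chi x.
  by rewrite h normc0 => /eqP; rewrite eq_sym oner_eq0.
by apply: (mulfI c0); rewrite -normc_sqr normc_chi expr1n -chiD subrr chi0.
Qed.

Lemma chi_neq1 (x : 'F_p) : x != 0 -> chi x != 1.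
Proof.
move=> x0; have n0 : (0 < x)%N by rewrite lt0n.
have np : (x < p)%N by have := ltn_ord x; rewrite [X in (_ < X)%N -> _](Fp_cast pp).
have p0 : 0 < p%:R :> R by rewrite ltr0n prime_gt0.
apply/eqP; rewrite /chi e_E => -[] /eqP h _.
(* Half of the angle: it lies strictly between 0 and [pi], and [cos (2 y) = 1] would force
   [sin y = 0]. *)
pose y : R := pi * (x : nat)%:R / p%:R.
have E : th (x : nat)%:R = y *+ 2 by rewrite /th /y; ring.
have : 0 < sin y.
  apply: sin_gt0_pi; rewrite /y divr_gt0 ?mulr_gt0 ?pi_gt0 ?(ltr0n _ (nat_of_ord x)) //=.
  by rewrite ltr_pdivrMr // ltr_pM2l ?pi_gt0 // ltr_nat.
move: h; rewrite E cos_mulr2n cos2sin2 => h1 h2; have : 0 < sin y ^+ 2 by rewrite exprn_gt0.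
by move: h1 => /eqP; lra.
Qed.

Lemma chi_sum (h : 'F_p) : \sum_x chi (x * h) = if h == 0 then p%:R else 0.
Proof.
case: eqP => [->|/eqP h0].
  under eq_bigr do rewrite mulr0 chi0.
  by rewrite sumr_const card_Fp.
(* Translating [x] by 1 multiplies the sum by [chi h], which is not 1. *)
set S := LHS; apply/eqP; have : chi h * S == S.
  rewrite mulr_sumr [X in _ == X](reindex_inj (addIr 1)) /=.
  by apply/eqP/eq_bigr => x _; rewrite -chiD mulrDl mul1r addrC.
by rewrite -subr_eq0 -[X in _ - X]mul1r -mulrBl mulf_eq0 subr_eq0 (negPf (chi_neq1 _ h0)).
Qed.

Lemma parseval (g : 'F_p -> R[i]) :
  \sum_x normc (\sum_s g s * chi (x * s)) ^+ 2 = p%:R * \sum_s normc (g s) ^+ 2.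
Proof.
apply: (@complexI R); rewrite rmorph_sum rmorphM rmorph_nat rmorph_sum /=.
have sqE x : (normc (\sum_s g s * chi (x * s)) ^+ 2)%:C =
    \sum_s \sum_s' g s * (g s')^*%C * chi (x * (s - s')).
  have conjM (y z : R[i]) : (y * z)^*%C = y^*%C * z^*%C by exact: (rmorphM conjc).
  have -> : (normc (\sum_s g s * chi (x * s)) ^+ 2)%:C =
      (\sum_s g s * chi (x * s)) * \sum_s (g s * chi (x * s))^*%C.
    by rewrite normc_sqr; congr (_ * _); exact: (rmorph_sum conjc).
  rewrite big_distrlr; apply: eq_bigr => s _; apply: eq_bigr => s' _.
  by rewrite /= conjM chi_conj mulrACA -chiD -mulrN -mulrDr.
rewrite (eq_bigr _ (fun x _ => sqE x)).
rewrite exchange_big mulr_sumr /=; apply: eq_bigr => s _.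
rewrite exchange_big /=; under eq_bigr do rewrite -mulr_sumr chi_sum subr_eq0.
rewrite (bigD1 s) //= eqxx big1 ?addr0 => [|s' ss'].
  by rewrite -normc_sqr mulrC.
by rewrite eq_sym (negPf ss') mulr0.
Qed.

Lemma normc_ge0 (z : R[i]) : 0 <= normc z.
Proof. by case: z => a b; exact: sqrtr_ge0. Qed.

Lemma normc_sum (I : Type) (r : seq I) (P : pred I) (F : I -> R[i]) :
  normc (\sum_(i <- r | P i) F i) <= \sum_(i <- r | P i) normc (F i).
Proof. exact: (@ler_norm_sum R (Rcomplex R)). Qed.

Definition pair_fiber (I : finType) (P : pred I) (w : I -> 'F_p) (s : 'F_p) :=
  [pred z : I * I | P z.1 && P z.2 && (w z.1 + w z.2 == s)].

(** The square of the sum is again a Fourier sum, whose coefficient [g s] runs over the pairs with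
    [w i + w j = s]; Parseval applies to it, and each [g s] is at most the size of its fiber. *)
Lemma fourth_moment (I : finType) (P : pred I) (c : I -> R[i]) (w : I -> 'F_p) :
  (forall i, P i -> normc (c i) <= 1) ->
  \sum_x normc (\sum_(i | P i) c i * chi (x * w i)) ^+ 4 <=
  p%:R * \sum_s #|pair_fiber I P w s|%:R ^+ 2.
Proof.
move=> c1; pose g s := \sum_(z | pair_fiber I P w s z) c z.1 * c z.2.
have sqE x : (\sum_(i | P i) c i * chi (x * w i)) ^+ 2 = \sum_s g s * chi (x * s).
  rewrite expr2 big_distrlr pair_big /=.
  rewrite (partition_big (fun z => w z.1 + w z.2) predT) //=.
  apply: eq_bigr => s _; rewrite mulr_suml; apply: eq_bigr => z.
  by move=> /andP[_ /eqP <-]; rewrite mulrACA -chiD mulrDr.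
rewrite (eq_bigr (fun x => normc (\sum_s g s * chi (x * s)) ^+ 2)); last first.
  have normcX2 z : normc (z ^+ 2) = normc z ^+ 2 :> R by rewrite !expr2 normcM.
  by move=> x _; rewrite -sqE normcX2 -exprM.
rewrite parseval ler_wpM2l ?ler0n //; apply: ler_sum => s _.
rewrite ler_sqr ?nnegrE ?normc_ge0 ?ler0n //.
apply: le_trans (normc_sum _ _ _ _) _; rewrite -sum1_card natr_sum.
apply: ler_sum => z /andP[/andP[z1 z2] _].
by rewrite normcM mulr_ile1 ?normc_ge0 ?c1.
Qed.

(* For [s = 0] the fiber consists of the pairs with [w j = - w i], whence the
   extra [1] in [M.+1]. *)
Lemma sum_sqr_pair_fiber (I : finType) (P : pred I) (w : I -> 'F_p) (M : nat) :
  {in P &, injective w} ->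
  (forall s, s != 0 -> (#|pair_fiber I P w s| <= M)%N) ->
  (\sum_s #|pair_fiber I P w s| ^ 2 <= #|P| ^ 2 * M.+1)%N.
Proof.
move=> winj wM; set r := fun s => #|pair_fiber I P w s|.
have r0 : (r 0%R <= #|P|)%N.
  have finj : {in pair_fiber I P w 0 &, injective (fst : I * I -> I)}.
    move=> [i j] [i' j'] /= /andP[/andP[/= Pi Pj] /eqP h].
    move=> /andP[/andP[/= Pi' Pj'] /eqP h'] ii'; congr pair => //.
    by apply: winj => //; move: h; rewrite -h' ii' => /addrI.
  rewrite /r -(card_in_imset finj); apply: subset_leq_card.
  by apply/fintype.subsetP => i /imsetP[z /andP[/andP[Pz _] _] ->].
(* The fibers partition the pairs of elements of [P]. *)
have sumr : (\sum_s r s = #|P| ^ 2)%N.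
  rewrite expnS expn1 -cardX -sum1_card.
  rewrite (partition_big (fun z => w z.1 + w z.2) predT) //=.
  by apply: eq_bigr => s _; rewrite /r -sum1_card.
rewrite (bigD1 0%R) //= mulnS leq_add //; first by rewrite leq_exp2r.
apply: (@leq_trans (\sum_(s | s != 0%R) r s * M)%N).
  by apply: leq_sum => s s0; rewrite expnS expn1 leq_mul2l wM ?orbT.
by rewrite -big_distrl /= leq_mul2r -sumr [X in (_ <= X)%N](bigD1 0%R) //= leq_addl orbT.
Qed.

End character.

(** * Power means and the dyadic decomposition of intervals *)

(** Lagrange's identity: twice the difference of the two sides is the sum of all [(x i - x j)^2]. *)
Lemma sqr_sum_le (R : realType) (n : nat) (x : 'I_n -> R) :
  (\sum_i x i) ^+ 2 <= n%:R * \sum_i x i ^+ 2.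
Proof.
set S := \sum_i x i; set Q := \sum_i _.
have E i : \sum_(j < n) (x i - x j) ^+ 2 = x i ^+ 2 *+ n - 2 * (S * x i) + Q.
  under eq_bigr do rewrite sqrrB -mulr_natl.
  rewrite !big_split /= sumr_const card_ord sumrN -mulr_sumr -mulr_sumr.
  by rewrite [x i * _]mulrC.
have : 0 <= \sum_(i < n) \sum_(j < n) (x i - x j) ^+ 2.
  by do 2 (apply: sumr_ge0 => ? _); exact: sqr_ge0.
rewrite (eq_bigr _ (fun i _ => E i)) !big_split /= sumrN -mulr_sumr -mulr_sumr.
rewrite sumrMnl sumr_const card_ord -/S -/Q.
have -> : Q *+ n - 2 * (S * S) + Q *+ n = 2 * (n%:R * Q - S ^+ 2).
  by rewrite -mulr_natl; move: S Q n%:R {E} => S Q m; ring.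
by rewrite pmulr_rge0 // subr_ge0.
Qed.

Lemma pow4_sum_le (R : realType) (n : nat) (x : 'I_n -> R) :
  (\sum_i x i) ^+ 4 <= n%:R ^+ 3 * \sum_i x i ^+ 4.
Proof.
rewrite [_ ^+ 4](exprM _ 2 2).
apply: (@le_trans _ _ ((n%:R * \sum_i x i ^+ 2) ^+ 2)).
  rewrite ler_sqr ?nnegrE ?sqr_ge0 ?sqr_sum_le //.
  by rewrite mulr_ge0 // sumr_ge0 // => i _; exact: sqr_ge0.
rewrite exprMn (exprSr n%:R 2) -mulrA ler_wpM2l ?exprn_ge0 //.
apply: le_trans (sqr_sum_le _ _ _) _.
by under [in leRHS]eq_bigr do rewrite (exprM _ 2 2).
Qed.

Section dyadic.
Variables (R : realType) (B : nat -> nat -> R[i]) (K : nat) (T : nat -> R).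
Hypothesis Badd : forall l m n, (l <= m <= n)%N -> B l n = B l m + B m n.
Hypothesis BT : forall j b, (j < K)%N -> (b.+1 * 2 ^ j <= 2 ^ K)%N ->
  normc (B (b * 2 ^ j) (b.+1 * 2 ^ j)) <= T j.

(* The binary digits of [m] cut the prefix into at most one block per level. *)
Lemma dyadic_prefix (k c m : nat) : (k <= K)%N -> (c.+1 * 2 ^ k <= 2 ^ K)%N ->
  (m < 2 ^ k)%N -> normc (B (c * 2 ^ k) (c * 2 ^ k + m)) <= \sum_(j < k) T j.
Proof.
have B0 l : B l l = 0 by apply: (addrI (B l l)); rewrite addr0 -Badd ?leqnn.
elim: k c m => [|k IHk] c m kK cK mk.
  by rewrite (_ : m = 0%N) ?addn0 ?B0 ?normc0 ?big_ord0 //; lia.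
rewrite big_ord_recr /=; move: cK mk; rewrite expnS => cK mk.
have Tk : 0 <= T k.
  apply: le_trans (BT k 0 kK _); first exact: normc_ge0.
  by rewrite mul1n leq_exp2l // ltnW.
(* The binary digit of weight [2^k]: if it is 0, the prefix stays in the left half; otherwise the
   left half is a full block of level [k], followed by a prefix of the right half. *)
have [mk2|mk2] := ltnP m (2 ^ k).
  rewrite mulnA; apply: le_trans (IHk (c * 2)%N m _ _ mk2) _.
  - exact: ltnW.
  - by nia.
  - by rewrite lerDl.
rewrite mulnA (Badd _ (c * 2 * 2 ^ k + 2 ^ k)%N); last by lia.
apply: le_trans (le_normcD _ _) _; rewrite addrC lerD //.
  by rewrite -mulSnr; apply: BT => //; nia.
have -> : (c * 2 * 2 ^ k + m = (c * 2).+1 * 2 ^ k + (m - 2 ^ k))%N by lia.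
by rewrite -mulSnr; apply: IHk; [exact: ltnW|nia|lia].
Qed.

Lemma dyadic_interval (l m : nat) : (l <= m)%N -> (m < 2 ^ K)%N ->
  normc (B l m) <= 2 * \sum_(j < K) T j.
Proof.
move=> lm mK; have prefix n : (n < 2 ^ K)%N -> normc (B 0 n) <= \sum_(j < K) T j.
  by move=> nK; have := dyadic_prefix K 0 n; rewrite mul0n add0n mul1n; exact.
have -> : B l m = B 0 m - B 0 l.
  by rewrite (Badd 0 l m) ?lm // addrAC subrr add0r.
apply: le_trans (le_normcD _ _) _; rewrite normcN mulr_natl mulr2n lerD ?prefix //.
exact: leq_ltn_trans mK.
Qed.

End dyadic.

(** The level bound [T j] is the fourth root of the sum over all blocks of level [j], so it
    dominates each of them. The right-hand side no longer depends on [l] and [m], which lets the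
    endpoints vary with [v]. *)
Lemma dyadic_interval4 (R : realType) (B : nat -> nat -> R[i]) (K l m : nat) :
  (forall l m n, (l <= m <= n)%N -> B l n = B l m + B m n) ->
  (l <= m)%N -> (m < 2 ^ K)%N ->
  normc (B l m) ^+ 4 <= 16 * K%:R ^+ 3 *
    \sum_(j < K) \sum_(b < 2 ^ (K - j)) normc (B (b * 2 ^ j)%N (b.+1 * 2 ^ j)%N) ^+ 4.
Proof.
move=> Badd lm mK.
pose S (j : nat) := \sum_(b < 2 ^ (K - j)) normc (B (b * 2 ^ j)%N (b.+1 * 2 ^ j)%N) ^+ 4.
have S0 j : 0 <= S j by apply: sumr_ge0 => b _; rewrite exprn_ge0 ?normc_ge0.
pose T j := Num.sqrt (Num.sqrt (S j)).
have T4 j : T j ^+ 4 = S j by rewrite (exprM _ 2 2) !sqr_sqrtr ?sqrtr_ge0.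
have T0 j : 0 <= T j by exact: sqrtr_ge0.
have BT j b : (j < K)%N -> (b.+1 * 2 ^ j <= 2 ^ K)%N ->
    normc (B (b * 2 ^ j)%N (b.+1 * 2 ^ j)%N) <= T j.
  move=> jK bK; have bK' : (b < 2 ^ (K - j))%N.
    have j0 : (0 < 2 ^ j)%N by rewrite expn_gt0.
    rewrite -(ltn_pmul2r j0) -expnD subnK; last exact: ltnW.
    by apply: leq_trans bK; rewrite ltn_pmul2r.
  rewrite -(@ler_pXn2r _ 4) ?nnegrE ?normc_ge0 ?T0 // T4 /S.
  rewrite (bigD1 (Ordinal bK')) //= lerDl.
  by apply: sumr_ge0 => ? _; rewrite exprn_ge0 ?normc_ge0.
have h := dyadic_interval R B K T Badd BT l m lm mK.
apply: (@le_trans _ _ ((2 * \sum_(j < K) T j) ^+ 4)).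
  by rewrite ler_pXn2r ?nnegrE ?normc_ge0 // mulr_ge0 // sumr_ge0.
have -> : (2 * \sum_(j < K) T j) ^+ 4 = 16 * (\sum_(j < K) T j) ^+ 4.
  by rewrite exprMn -natrX.
rewrite -mulrA ler_wpM2l //.
apply: le_trans (pow4_sum_le _ _ _) _.
by under eq_bigr do rewrite T4.
Qed.

(** * Rows of a convex set *)

(** Induction on [U]: when [P U] holds, either the earlier interval is empty and the new one starts
    at [U], or the hypothesis fills the gap up to [U]. *)
Lemma interval_pred (P : pred nat) (U : nat) :
  (forall i j k, (i <= j <= k)%N -> (k < U)%N -> P i -> P k -> P j) ->
  exists l m, (l <= m <= U)%N /\ forall i, (i < U)%N -> P i = (l <= i < m)%N.
Proof.
elim: U => [|U IHU] cP; first by exists 0%N, 0%N.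
have [|l [m [/andP[lm mU] E]]] := IHU.
  by move=> i j k ijk kU; apply: cP ijk _; exact: ltnW.
have ltSP i : (i < U.+1)%N -> i = U \/ (i < U)%N by lia.
have [PU|PU] := boolP (P U); last first.
  exists l, m; split=> [|i]; first lia.
  by move=> /ltSP[->|/E //]; rewrite (negPf PU); lia.
have [lm'|lm'] := ltnP l m; last first.
  exists U, U.+1; split=> [|i]; first lia.
  by move=> /ltSP[->|iU]; rewrite ?PU ?E //; lia.
exists l, U.+1; split=> [|i]; first lia.
move=> /ltSP[->|iU]; first by rewrite PU; lia.
have [li|li] := leqP l i; last by rewrite E //; lia.
rewrite ltnS (ltnW iU); apply: (cP l i U) => //; first by lia.
by rewrite E; lia.
Qed.

Lemma convex_set_row (R : realType) (C : set (R^o * R^o)) (i j k y : R) :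
  convex_set C -> i <= j <= k -> C (i, y) -> C (k, y) -> C (j, y).
Proof.
move=> cC /andP[ij jk] Ci Ck.
have [ik|ik] := eqVneq i k.
  by have -> : j = i by apply/eqP; rewrite eq_le ij andbT [leRHS]ik.
have ki : 0 < k - i by rewrite subr_gt0 lt_neqAle ik (le_trans ij).
pose t := (k - j) / (k - i).
have t0 : 0 <= t by rewrite divr_ge0 ?subr_ge0 ?(le_trans ij).
have t1 : t <= 1 by rewrite ler_pdivrMr // mul1r lerB.
have := cC _ _ (Itv01 t0 t1) (mem_set Ci) (mem_set Ck); rewrite inE.
congr C; rewrite /conv /=; congr pair.
  by rewrite -[LHS]/(t * i + (1 - t) * k) /t; field; rewrite gt_eqF.
by rewrite -[LHS]/(t * y + (1 - t) * y); ring.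
Qed.

(** * Sums of two reciprocals of values of the linear form *)

Section fiber.
Variables (p U : nat) (a b : 'F_p).
Hypotheses (pp : prime p) (Up : (U < p)%N) (a0 : a != 0).

(* The index is shifted by one: [i : 'I_U] stands for [u = i + 1]. *)
Definition lin_den (i : nat) : 'F_p := a * i.+1%:R + b.

Lemma natr_Fp_inj (i j : nat) : (i < p)%N -> (j < p)%N ->
  i%:R = j%:R :> 'F_p -> i = j.
Proof.
move=> ip jp /(congr1 (fun x : 'F_p => nat_of_ord x)).
by rewrite !val_Fp_nat // !modn_small.
Qed.

Lemma inv_lin_den_inj : injective (fun i : 'I_U => (lin_den i)^-1).
Proof.
move=> i j /invr_inj /addIr /(mulfI a0) ij; apply: val_inj.
apply/eq_add_S/natr_Fp_inj => //; exact: leq_ltn_trans (ltn_ord _) Up.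
Qed.

(** The equation [1/x + 1/y = s] reads [(x - 1/s)(y - 1/s) = 1/s^2]; dividing by [a^2] gives a
    hyperbola in the indices. The summand 1 in its shift comes from [u = i + 1]. *)
Lemma pair_fiber_lin_den (T X D : nat) (P : pred 'I_U) (s : 'F_p) :
  (0 < T < p)%N -> (T * U ^ 2 + 2 * U * (p %/ T) <= X)%N ->
  (forall n, (0 < n <= p ^ 6)%N -> (size (divisors n) <= D)%N) ->
  (forall i, P i -> lin_den i != 0) -> s != 0 ->
  (#|pair_fiber p _ P (fun i => (lin_den i)^-1) s| <= ((2 * X) %/ p).+1 * (2 * D))%N.
Proof.
move=> Tp TX hD Pd s0.
apply: (@hyperbola_count _ U T X D (1 + b / a - (a * s)^-1) ((a * s) ^- 2)) => //.
  by rewrite invr_eq0 expf_eq0 mulf_eq0 (negPf a0) (negPf s0).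
move=> [i j] /andP[/andP[/= /Pd x0 /Pd y0] /eqP es].
have shift (k : 'I_U) : k%:R + (1 + b / a - (a * s)^-1) = (lin_den k - s^-1) / a.
  rewrite /lin_den -natr1; move: (k : nat)%:R s0 => n s0; field.
  by rewrite a0 s0.
rewrite !shift; move: s0; rewrite -es {shift es}.
move: (lin_den i) (lin_den j) x0 y0 => x y x0 y0 s0.
have xy0 : x + y != 0.
  apply: contraNneq s0 => xy; apply/eqP.
  have -> : x = - y by apply/eqP; rewrite -addr_eq0 xy.
  by rewrite invrN addNr.
by field; rewrite a0 x0 y0 addrC xy0.
Qed.

End fiber.

Lemma ler_sum_inj (R : realType) (I J : finType) (f : I -> J) (G : J -> R) :
  injective f -> (forall j, 0 <= G j) -> \sum_i G (f i) <= \sum_j G j.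
Proof.
move=> finj G0; rewrite -(big_imset _ (in2W finj)).
by rewrite [leRHS](bigID (mem (f @: predT))) /= lerDl sumr_ge0.
Qed.

(** * The fourth power of the bilinear sum *)

Section moment.
Variables (R : realType) (p U V K T X D : nat) (a b : 'F_p).
Variables (alpha beta : nat -> R[i]) (C : set (R^o * R^o)).
Hypotheses (pp : prime p) (Up : (U < p)%N) (Vp : (V < p)%N) (a0 : a != 0).
Hypotheses (alpha1 : forall u, (1 <= u <= U)%N -> normc (alpha u) <= 1).
Hypotheses (beta1 : forall v, (1 <= v <= V)%N -> normc (beta v) <= 1).
Hypothesis convC : convex_set C.
Hypotheses (UK : (U < 2 ^ K)%N) (Tp : (0 < T < p)%N).
Hypothesis TX : (T * U ^ 2 + 2 * U * (p %/ T) <= X)%N.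
Hypothesis hD : forall n, (0 < n <= p ^ 6)%N -> (size (divisors n) <= D)%N.

Let d := lin_den p a b.
Let M := (((2 * X) %/ p).+1 * (2 * D))%N.
Let block (m n : nat) : pred 'I_U := fun i => (d i != 0) && (m <= i < n)%N.
(** The inner sum of a row, with [v] relaxed to any [x] of the field and the row to any interval. *)
Let B (x : 'F_p) (m n : nat) : R[i] :=
  \sum_(i | block m n i) alpha i.+1 * chi R p (x * (d i)^-1).

Lemma block_moment (m n : nat) :
  \sum_x normc (B x m n) ^+ 4 <= p%:R * ((n - m) ^ 2 * M.+1)%:R.
Proof.
apply: le_trans (fourth_moment R p pp _ _ _ _ _) _.
  by move=> i _; apply: alpha1; exact: ltn_ord.
rewrite ler_wpM2l //; under eq_bigr do rewrite -natrX.
rewrite -natr_sum ler_nat.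
apply: leq_trans (sum_sqr_pair_fiber p _ _ _ M _ _) _.
- exact: (in2W (inv_lin_den_inj p U a b pp Up a0)).
- by move=> s s0; apply: (pair_fiber_lin_den p U a b pp Up a0 T X D) => // i /andP[].
rewrite leq_mul2r leq_exp2r //; apply/orP; right.
rewrite -(size_iota m (n - m)) cardE -(size_map (fun i : 'I_U => nat_of_ord i)).
apply: uniq_leq_size; first by rewrite map_inj_uniq ?enum_uniq //; exact: val_inj.
move=> k /mapP[j]; rewrite mem_enum => /andP[_ /andP[mj jn]] ->.
by rewrite mem_iota; lia.
Qed.

Lemma B_add (x : 'F_p) (l m n : nat) : (l <= m <= n)%N ->
  B x l n = B x l m + B x m n.
Proof.
move=> /andP[lm mn]; rewrite /B (bigID (fun i : 'I_U => (i < m)%N)) /=.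
by congr (_ + _); apply: eq_bigl => i; rewrite /block -andbA; congr (_ && _); lia.
Qed.

(** Convexity enters here: each row is an interval, whose endpoints are picked for all [v] at once
    by choice. *)
Lemma Ksum_rows : exists l m : 'I_V -> nat,
  (forall v, (l v <= m v <= U)%N) /\
  Ksum U V a b alpha beta C = \sum_(v < V) beta v.+1 * B v.+1%:R (l v) (m v).
Proof.
pose P (v i : nat) := ((i.+1%:R, v.+1%:R) : R^o * R^o) \in C.
have row (v : 'I_V) : exists lm : nat * nat, (lm.1 <= lm.2 <= U)%N /\
    forall i, (i < U)%N -> P v i = (lm.1 <= i < lm.2)%N.
  have [|l [m h]] := interval_pred (P v) U; last by exists (l, m).
  move=> i j k ijk _; rewrite /P !inE; apply: convex_set_row => //.
  by rewrite !ler_nat !ltnS.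
have [lm hlm] := boolp.choice row.
exists (fun v => (lm v).1), (fun v => (lm v).2); split=> [v|].
  by have [] := hlm v.
rewrite /Ksum; under eq_bigr do rewrite big_add1 big_mkord big_mkcond /=.
rewrite big_add1 big_mkord /=.
rewrite exchange_big /=; apply: eq_bigr => v _.
rewrite -big_mkcond /= mulr_sumr; apply: eq_big => [i|i _].
  by rewrite /block -(hlm v).2 // andbC.
by rewrite [RHS]mulrCA mulrA.
Qed.

Lemma Ksum_pow4 :
  normc (Ksum U V a b alpha beta C) ^+ 4 <=
  V%:R ^+ 3 * (16 * K%:R ^+ 4 * (4 ^ K * p * M.+1)%:R).
Proof.
have [l [m [lmU ->]]] := Ksum_rows.
apply: (@le_trans _ _ ((\sum_(v < V) normc (B v.+1%:R (l v) (m v))) ^+ 4)).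
  have S0 : 0 <= \sum_(v < V) normc (B v.+1%:R (l v) (m v)).
    by apply: sumr_ge0 => v _; exact: normc_ge0.
  rewrite ler_pXn2r ?nnegrE ?normc_ge0 //.
  apply: le_trans (normc_sum _ _ _ _ _) _; apply: ler_sum => v _.
  by rewrite normcM ler_piMl ?normc_ge0 // beta1 //; exact: ltn_ord.
apply: le_trans (pow4_sum_le _ _ _) _; rewrite ler_wpM2l ?exprn_ge0 //.
(* A nonnegative majorant free of the row endpoints, so that the sum over [v] may be extended to the
   whole field. *)
pose G (x : 'F_p) := 16 * K%:R ^+ 3 * \sum_(j < K) \sum_(c < 2 ^ (K - j))
   normc (B x (c * 2 ^ j)%N (c.+1 * 2 ^ j)%N) ^+ 4.
have G0 x : 0 <= G x.
  rewrite /G mulr_ge0 ?mulr_ge0 ?exprn_ge0 //.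
  by do 2 (apply: sumr_ge0 => ? _); rewrite exprn_ge0 ?normc_ge0.
apply: (@le_trans _ _ (\sum_(v < V) G v.+1%:R)).
  apply: ler_sum => v _; have /andP[lm mU] := lmU v.
  by apply: dyadic_interval4 (leq_ltn_trans mU UK) => //; exact: B_add.
apply: (@le_trans _ _ (\sum_x G x)).
  apply: (ler_sum_inj R _ _ (fun v : 'I_V => v.+1%:R)) => // u v uv.
  apply/val_inj/eq_add_S/(natr_Fp_inj p pp) => //; exact: leq_ltn_trans (ltn_ord _) Vp.
rewrite -mulr_sumr (exprSr _ 3) mulrA -[leRHS]mulrA ler_wpM2l ?mulr_ge0 ?exprn_ge0 //.
rewrite exchange_big /=.
(* Level [j] has [2^(K-j)] blocks of length [2^j], contributing [2^(K+j) p (M+1)], at most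
   [4^K p (M+1)]; the [K] levels turn [K^3] into [K^4]. *)
apply: (@le_trans _ _ (\sum_(j < K) (4 ^ K * p * M.+1)%:R)); last first.
  by rewrite sumr_const card_ord mulr_natl.
apply: ler_sum => j _; rewrite exchange_big /=.
apply: (@le_trans _ _ (\sum_(c < 2 ^ (K - j)) (p * ((2 ^ j) ^ 2 * M.+1))%:R)).
  apply: ler_sum => c _; apply: le_trans (block_moment _ _) _.
  by rewrite -natrM ler_nat mulSn addnK.
rewrite sumr_const card_ord -mulrnA ler_nat.
have -> : (p * ((2 ^ j) ^ 2 * M.+1) * 2 ^ (K - j) =
    2 ^ (K - j) * 2 ^ j * 2 ^ j * p * M.+1)%N by ring.
rewrite !leq_mul2r; apply/orP; right; apply/orP; right.
rewrite -expnD subnK; last exact: ltnW.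
rewrite (_ : 4 ^ K = 2 ^ K * 2 ^ K)%N; last by rewrite -expnMn.
by rewrite leq_mul2l leq_exp2l // (ltnW (ltn_ord j)) orbT.
Qed.
End moment.

(** * Maximal number of divisors and choice of the parameter [T] *)

(* [divisors 0 = [:: 1]], hence the index 0 is harmless. *)
Definition max_divisors (N : nat) : nat := \max_(n < N.+1) size (divisors n).

Lemma max_divisorsP (N n : nat) : (n <= N)%N -> (size (divisors n) <= max_divisors N)%N.
Proof.
by move=> nN; rewrite /max_divisors (bigop.leq_bigmax (Ordinal (nN : n < N.+1)%N)).
Qed.

Lemma max_divisors_gt0 (N : nat) : (0 < N)%N -> (0 < max_divisors N)%N.
Proof. exact: max_divisorsP. Qed.

Lemma max_divisors_bound (k N : nat) : (0 < k)%N -> (0 < N)%N ->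
  (max_divisors N ^ k <= (k ^ k) ^ (2 ^ k) * N)%N.
Proof.
move=> k0 N0; rewrite /max_divisors.
have [|[n nN] ->] := @bigop.eq_bigmax _ (fun n : 'I_N.+1 => size (divisors n)).
  by rewrite card_ord.
case: n nN => [|n] nN /=.
  by rewrite exp1n muln_gt0 !expn_gt0 k0 N0.
apply: leq_trans (divisor_bound _ _ k0 _) _ => //.
by rewrite leq_mul2l -ltnS nN orbT.
Qed.

Lemma succ_log_le_max_divisors (m N : nat) : (2 ^ m <= N)%N -> (m < max_divisors N)%N.
Proof.
move=> mN; apply: leq_trans (max_divisorsP _ _ mN).
rewrite -[leqLHS](size_iota 0) -(size_map (expn 2)).
apply: uniq_leq_size.
  by rewrite map_inj_uniq ?iota_uniq //; exact: expnI.
move=> k /mapP[j]; rewrite mem_iota => /andP[_ jm] ->.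
by rewrite -dvdn_divisors ?expn_gt0 // dvdn_exp2l.
Qed.

(** Take the largest [T] with [U T^2 <= p]. Up to constants, both [T U^2] and [U p / T] are then at
    most the square root of [p U^3]. *)
Lemma exists_balanced (p U : nat) : (1 < p)%N -> (1 <= U < p)%N ->
  exists T, (0 < T < p)%N /\
    ((T * U ^ 2 + 2 * U * (p %/ T)) ^ 2 <= 25 * (p * U ^ 3))%N.
Proof.
move=> p1 /andP[U0 Up].
have exT : exists T, (U * T ^ 2 <= p)%N by exists 0%N; rewrite exp0n ?muln0.
have bT T : (U * T ^ 2 <= p)%N -> (T <= p)%N by rewrite expnS expn1; nia.
have [T Tle Tmax] := ex_maxnP exT bT.
have T0 : (0 < T)%N by apply: Tmax; rewrite exp1n muln1 ltnW.
have Tlt : (p < U * T.+1 ^ 2)%N.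
  by rewrite ltnNge; apply/negP => /Tmax; rewrite ltnn.
exists T; split.
  by rewrite T0 /=; move: Tle; rewrite expnS expn1; nia.
have p4 : (p <= 4 * (U * T ^ 2))%N.
  apply: leq_trans (ltnW Tlt) _; rewrite mulnCA leq_mul2l; apply/orP; right.
  by rewrite -[4%N]/(2 ^ 2)%N -expnMn leq_exp2r //; lia.
set x := (T * U ^ 2)%N; set y := (U * (p %/ T))%N.
have hx : (x ^ 2 <= p * U ^ 3)%N.
  rewrite /x expnMn -expnM (_ : 2 * 2 = 1 + 3)%N // expnD expn1 mulnA leq_mul2r.
  by rewrite mulnC Tle orbT.
have hy : (y ^ 2 <= 4 * (p * U ^ 3))%N.
  have T20 : (0 < T ^ 2)%N by rewrite expn_gt0 T0.
  rewrite -(leq_pmul2r T20) -expnMn /y -mulnA.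
  apply: (@leq_trans ((U * p) ^ 2)).
    by rewrite leq_exp2r // leq_mul2l leq_divM orbT.
  apply: (@leq_trans (U ^ 2 * (p * (4 * (U * T ^ 2))))).
    by rewrite expnMn leq_mul2l (expnS p) expn1 leq_mul2l p4 !orbT.
  by rewrite !expnS !expn0; lia.
(* With [x^2 <= z] and [y^2 <= 4 z], Cauchy for [2 x] and [y] gives [4 x y <= 8 z], so
   [(x + 2 y)^2 <= (1 + 8 + 16) z]. *)
rewrite -mulnA -/y; move: x y (p * U ^ 3)%N (nat_Cauchy (2 * x) y).1 hx hy => x y z.
by rewrite !expnS !expn0 !muln1; nia.
Qed.

(** * The explicit bound in terms of real powers *)

Lemma powR_pow4 (R : realType) (x y : R) : (x `^ y) ^+ 4 = x `^ (y * 4).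
Proof. by rewrite -powR_mulrn ?powR_ge0 // -powRrM. Qed.

(** The fourth powers of the two terms are [U^2 (p U^3)^(1/2)] and [U^2 p], and
    [x^4 + y^4 <= (x + y)^4] for nonnegative [x], [y]. *)
Lemma bound_pow4 (R : realType) (p U V : nat) (e : R) :
  (0 < p)%N -> (0 < U)%N ->
  V%:R ^+ 3 * (U%:R ^+ 2 * (Num.sqrt (p * U ^ 3)%:R + p%:R)) * p%:R `^ (e * 4) <=
  (V%:R `^ (3 / 4) *
    (U%:R `^ (7 / 8) * p%:R `^ (1 / 8) + U%:R `^ (1 / 2) * p%:R `^ (1 / 4)) *
    p%:R `^ e) ^+ 4.
Proof.
move=> p0 U0.
have natR n : 0 <= n%:R :> R by [].
have pR : 0 < p%:R :> R by rewrite ltr0n.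
have UR : 0 < U%:R :> R by rewrite ltr0n.
have V4 : (V%:R `^ (3 / 4)) ^+ 4 = V%:R ^+ 3 :> R.
  by rewrite powR_pow4 (_ : 3 / 4 * 4 = 3%:R :> R) ?powR_mulrn //; field.
have A4 : (U%:R `^ (7 / 8) * p%:R `^ (1 / 8)) ^+ 4 =
    U%:R ^+ 2 * Num.sqrt (p * U ^ 3)%:R :> R.
  have -> : Num.sqrt (p * U ^ 3)%:R = U%:R `^ (3 / 2) * p%:R `^ (1 / 2) :> R.
    rewrite -powR12_sqrt // mulnC natrM natrX powRM ?exprn_ge0 // -powR_mulrn //.
    by rewrite -powRrM mul1r.
  rewrite exprMn !powR_pow4 mulrA -(powR_mulrn 2) // -powRD; last first.
    by rewrite gt_eqF ?implybT.
  by congr (_ `^ _ * _ `^ _); field.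
have B4 : (U%:R `^ (1 / 2) * p%:R `^ (1 / 4)) ^+ 4 = U%:R ^+ 2 * p%:R :> R.
  rewrite exprMn !powR_pow4 (_ : 1 / 2 * 4 = 2%:R :> R); last by field.
  by rewrite (_ : 1 / 4 * 4 = 1 :> R) ?powRr1 ?powR_mulrn //; field.
rewrite !exprMn V4 powR_pow4 ler_wpM2r ?powR_ge0 // ler_wpM2l ?exprn_ge0 //.
rewrite mulrDr -A4 -B4.
have a0 : 0 <= U%:R `^ (7 / 8) * p%:R `^ (1 / 8) :> R by rewrite mulr_ge0 ?powR_ge0.
have b0 : 0 <= U%:R `^ (1 / 2) * p%:R `^ (1 / 4) :> R by rewrite mulr_ge0 ?powR_ge0.
move: (_ * _) (U%:R `^ (1 / 2) * _) a0 b0 => x y x0 y0.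
rewrite -subr_ge0.
have -> : (x + y) ^+ 4 - (x ^+ 4 + y ^+ 4) =
  4 * x ^+ 3 * y + 6 * x ^+ 2 * y ^+ 2 + 4 * x * y ^+ 3 by ring.
by rewrite !addr_ge0 // !mulr_ge0 // exprn_ge0.
Qed.

(** The constant is [16 * 4 * 32]: 16 from the dyadic step, 4 from [4^K <= 4 U^2], 32 from the count
    of solutions. Of the five divisor factors, four absorb [K^4] and one comes from the
    hyperbola. *)
Lemma Ksum_bound (R : realType) (p U V : nat) (a b : 'F_p)
    (alpha beta : nat -> R[i]) (C : set (R^o * R^o)) :
  prime p -> (1 <= U < p)%N -> (V < p)%N -> a != 0 -> convex_set C ->
  (forall u, (1 <= u <= U)%N -> normc (alpha u) <= 1) ->
  (forall v, (1 <= v <= V)%N -> normc (beta v) <= 1) ->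
  normc (Ksum U V a b alpha beta C) ^+ 4 <=
  V%:R ^+ 3 * (U%:R ^+ 2 * (Num.sqrt (p * U ^ 3)%:R + p%:R)) *
    (2 ^+ 11 * (max_divisors (p ^ 6))%:R ^+ 5).
Proof.
move=> pp Up Vp a0 cC alpha1 beta1; have p1 := prime_gt1 pp.
have [T [Tp TX]] := exists_balanced p U p1 Up.
case/andP: Up => U0 Up.
set D := max_divisors (p ^ 6).
have hD n : (0 < n <= p ^ 6)%N -> (size (divisors n) <= D)%N.
  by move=> /andP[_]; exact: max_divisorsP.
pose K := (trunc_log 2 U).+1.
have UK : (U < 2 ^ K)%N by exact: trunc_log_ltn.
have KU : (2 ^ trunc_log 2 U <= U)%N by rewrite trunc_logP.
have KD : (K <= D)%N.
  (* A power [2 ^ m] has [m + 1] divisors, so the logarithm is absorbed by [D]. *)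
  apply: succ_log_le_max_divisors; apply: leq_trans KU _.
  by apply: leq_trans (ltnW Up) _; rewrite -{1}(expn1 p) leq_exp2l.
have D0 : (0 < D)%N by exact: leq_trans KD.
set X := (T * U ^ 2 + 2 * U * (p %/ T))%N in TX.
apply: le_trans (Ksum_pow4 R p U V K T X D a b alpha beta C
  pp Up Vp a0 alpha1 beta1 cC UK Tp (leqnn _) hD) _.
rewrite -[leRHS]mulrA -[16 * _ * _]mulrA ler_wpM2l ?exprn_ge0 //.
set M := (_ * (2 * D))%N.
set S : R := Num.sqrt _.
have X5 : X%:R <= 5 * S.
  rewrite -(@ler_pXn2r _ 2) ?nnegrE ?mulr_ge0 ?sqrtr_ge0 //.
  by rewrite exprMn sqr_sqrtr // -!natrX -natrM ler_nat.
(* Here [2 X + p <= 10 S + p], and [M + 1] costs a factor [3 D] since [D >= 1]; 32 leaves room above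
   30. *)
have pM : (p * M.+1)%:R <= 32 * D%:R * (S + p%:R).
  have h : (p * M.+1 <= (2 * X + p) * (3 * D))%N.
    have : (p * ((2 * X) %/ p) <= 2 * X)%N by rewrite mulnC leq_divM.
    rewrite /M; move: (_ %/ _)%N => q hq.
    apply: (@leq_trans ((p * q + p) * (3 * D))); first nia.
    by rewrite leq_mul2r leq_add2r hq orbT.
  have S0 : 0 <= S by exact: sqrtr_ge0.
  apply: (@le_trans _ _ ((2 * X + p) * (3 * D))%:R); first by rewrite ler_nat.
  rewrite !natrM natrD natrM.
  have Dr : 0 <= D%:R :> R by [].
  have pr : 0 <= p%:R :> R by [].
  nra.
have K4 : (4 ^ K)%:R <= 4 * U%:R ^+ 2 :> R.
  rewrite -natrX -natrM ler_nat /K expnS leq_mul2l /= -[4%N]/(2 ^ 2)%N -expnM mulnC expnM.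
  by rewrite leq_exp2r.
have KD4 : K%:R ^+ 4 <= D%:R ^+ 4 :> R by rewrite -!natrX ler_nat leq_exp2r.
rewrite -mulnA natrM.
apply: (@le_trans _ _ (16 * (D%:R ^+ 4 * (4 * U%:R ^+ 2 * (32 * D%:R * (S + p%:R)))))).
  rewrite ler_wpM2l // ler_pM ?exprn_ge0 ?mulr_ge0 //.
  by rewrite ler_pM.
by rewrite le_eqVlt; apply/orP; left; apply/eqP; ring.
Qed.

(** * The exponent hidden in [p^o(1)] and its limit *)

(** Solved from the requirement that [p^(4 eps)] equal the loss factor of [Ksum_bound]. *)
Definition eps_div (R : realType) (p : nat) : R :=
  ln (2 ^+ 11 * (max_divisors (p ^ 6))%:R ^+ 5) / (4 * ln p%:R).

Lemma powR_eps_div (R : realType) (p : nat) : (1 < p)%N ->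
  p%:R `^ (eps_div R p * 4) = 2 ^+ 11 * (max_divisors (p ^ 6))%:R ^+ 5.
Proof.
move=> p1; have p0 := ltnW p1.
have lnp : 0 < ln p%:R :> R by rewrite ln_gt0 // ltr1n.
have F0 : 0 < 2 ^+ 11 * (max_divisors (p ^ 6))%:R ^+ 5 :> R.
  by rewrite mulr_gt0 // exprn_gt0 // ltr0n max_divisors_gt0 // expn_gt0 p0.
rewrite /powR gt_eqF ?ltr0n // -[RHS]lnK // /eps_div; congr expR.
by move: (ln _) (ln _) lnp => x y y0; field; rewrite gt_eqF.
Qed.

(** The divisor bound at [p^6] gives [k ln D <= ln c + 6 ln p]. The main term is thus
    [5 * 6 / (4 k)], rounded up to [8 / k]; [k] stays free and the rest decays like [1 / ln p]. *)
Lemma eps_div_le (R : realType) (k p : nat) : (0 < k)%N -> (1 < p)%N ->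
  0 <= eps_div R p <= 8 / k%:R +
    (ln (2 ^+ 11) + 5 * ln ((k ^ k) ^ (2 ^ k))%:R) / ln p%:R.
Proof.
move=> k0 p1; have p0 := ltnW p1.
have lnp : 0 < ln p%:R :> R by rewrite ln_gt0 // ltr1n.
have p60 : (0 < p ^ 6)%N by rewrite expn_gt0 p0.
have := max_divisors_bound k _ k0 p60; have := max_divisors_gt0 _ p60; rewrite /eps_div.
have : (0 < (k ^ k) ^ 2 ^ k)%N by rewrite !expn_gt0 k0.
move: (max_divisors _) (((k ^ k) ^ (2 ^ k))%N) => D c c0 D0 h.
have DR : 0 < D%:R :> R by rewrite ltr0n.
have D1 : 0 <= ln D%:R :> R by rewrite ln_ge0 ?ler1n.
have c1 : 0 <= ln c%:R :> R by rewrite ln_ge0 ?ler1n.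
have l0 : 0 <= ln (2 ^+ 11) :> R by rewrite ln_ge0 // exprn_ege1 // ler1n.
have kD : k%:R * ln D%:R <= ln c%:R + 6 * ln p%:R :> R.
  rewrite !mulr_natl -!lnXn ?ltr0n // -lnM ?posrE ?exprn_gt0 ?ltr0n //.
  rewrite ler_ln ?posrE ?mulr_gt0 ?exprn_gt0 ?ltr0n //.
  by rewrite -!natrX -natrM ler_nat.
have kR : 1 <= k%:R :> R by rewrite ler1n.
rewrite lnM ?posrE ?exprn_gt0 ?ltr0n // (lnXn 5 DR) -[_ *+ 5]mulr_natl.
move: (ln (2 ^+ 11)) (ln D%:R) (ln c%:R) (ln p%:R) (k%:R) kR D1 c1 l0 kD lnp.
move=> l d q y x x1 d0 q0 l0 xd y0; have x0 : 0 < x by lra.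
rewrite divr_ge0 /=; [|lra|lra].
have -> : 8 / x + (l + 5 * q) / y = (8 * y + (l + 5 * q) * x) / (x * y).
  by field; rewrite !gt_eqF.
rewrite ler_pdivlMr ?mulr_gt0 // mulrAC ler_pdivrMr ?mulr_gt0 //.
have lx : 0 <= l * x by rewrite mulr_ge0 // ltW.
have qx : 0 <= q * (x - 1) by rewrite mulr_ge0 // subr_ge0.
have key : 0 <= 4 * (8 * y + (l + 5 * q) * x) - (l + 5 * d) * x by lra.
by rewrite -subr_ge0; have := mulr_ge0 key (ltW y0); lra.
Qed.

Lemma eps_div_cvg0 (R : realType) : eps_div R @ \oo --> (0 : R).
Proof.
apply/cvgrPdist_le => e e0.
(* First [k] is fixed to bring [8 / k] below [e / 2]; then [N] makes the remaining term small for
   this [k]. *)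
pose k := (Num.truncn (16 / e)).+1.
have ke : 8 / k%:R <= e / 2.
  have : 16 / e < k%:R by rewrite /k truncnS_gt.
  rewrite ltr_pdivrMr // => h; rewrite ler_pdivrMr ?ltr0n //; lra.
set c := ln (2 ^+ 11) + 5 * ln ((k ^ k) ^ (2 ^ k))%:R : R.
pose N := (Num.truncn (expR (2 * c / e))).+1.
exists (maxn 2 N) => // p /=; rewrite geq_max => /andP[p1 Np].
have lnp : 0 < ln p%:R :> R by rewrite ln_gt0 // ltr1n.
have /andP[E0 E1] := eps_div_le R k p isT p1.
rewrite sub0r normrN ger0_norm //; apply: le_trans E1 _.
suff : c / ln p%:R <= e / 2 by move: ke; rewrite -/c; lra.
rewrite ler_pdivrMr //.
suff : 2 * c / e <= ln p%:R by rewrite ler_pdivrMr //; lra.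
rewrite -ler_expR lnK ?posrE ?ltr0n ?(ltnW p1) //.
apply: le_trans (_ : N%:R <= _); last by rewrite ler_nat.
by rewrite ltW // truncnS_gt.
Qed.

Theorem theorem2p4 (R : realType) :
  exists eps : nat -> R,
    eps @ \oo --> (0 : R) /\
    forall (p U V : nat) (a b : 'F_p) (C : set (R^o * R^o))
           (alpha beta : nat -> R[i]),
      prime p ->
      (1 <= U < p)%N -> (1 <= V < p)%N ->
      a != 0 ->
      C `<=` (`[1, U%:R] `*` `[1, V%:R]) ->
      convex_set C ->
      (forall u : nat, (1 <= u <= U)%N -> `|alpha u| <= 1) ->
      (forall v : nat, (1 <= v <= V)%N -> `|beta v| <= 1) ->
      `|Ksum U V a b alpha beta C| <=
        (V%:R `^ (3 / 4) *
         (U%:R `^ (7 / 8) * p%:R `^ (1 / 8) + U%:R `^ (1 / 2) * p%:R `^ (1 / 4)) *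
         p%:R `^ (eps p))%:C.
Proof.
(* This exponent depends on [p] alone, which gives the uniformity in all the other data. *)
exists (eps_div R); split; first exact: eps_div_cvg0.
move=> p U V a b C alpha beta pp Up /andP[_ Vp] a0 _ cC alpha1 beta1.
have p1 := prime_gt1 pp.
have normcE1 z : `|z| <= 1 -> normc z <= 1 :> R by rewrite -lecR.
have E0 : 0 <= V%:R `^ (3 / 4) *
    (U%:R `^ (7 / 8) * p%:R `^ (1 / 8) + U%:R `^ (1 / 2) * p%:R `^ (1 / 4)) *
    p%:R `^ (eps_div R p) :> R.
  by rewrite !mulr_ge0 ?addr_ge0 ?mulr_ge0 ?powR_ge0.
suff h : normc (Ksum U V a b alpha beta C) <= V%:R `^ (3 / 4) *
    (U%:R `^ (7 / 8) * p%:R `^ (1 / 8) + U%:R `^ (1 / 2) * p%:R `^ (1 / 4)) *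
    p%:R `^ (eps_div R p) by rewrite -lecR in h.
rewrite -(@ler_pXn2r _ 4) ?nnegrE ?normc_ge0 //.
apply: le_trans (bound_pow4 R p U V (eps_div R p) (ltnW p1) _); last by case/andP: Up.
rewrite powR_eps_div //; apply: Ksum_bound => // u hu; apply: normcE1.
  exact: alpha1.
exact: beta1.
Qed.
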